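(* Let $d \geq 3$ be an integer, and let $G=(V,E)$ be an $(n,d,\lambda)$-graph for some $\lambda < d$. Define $\psi:[0,\infty)\to\mathbb{R}$ by $\psi(x) = x+\sqrt{x^2-1}$ if $x\geq 1$, and $\psi(x)=1$ if $0\leq x\leq 1$. Then a non-backtracking random walk on $G$ converges to the uniform distribution, i.e. $\widetilde{P}^{(k)}_{uv}\to \frac1n$ as $k\to\infty$ for all $u,v\in V$, and its mixing rate $$\widetilde{\rho}=\widetilde{\rho}(G)=\limsup_{k\to\infty}\ \max_{u,v\in V}\left|\widetilde{P}^{(k)}_{uv}-\frac1n\right|^{1/k}$$ satisfies $$\widetilde{\rho}=\frac{1}{\sqrt{d-1}}\,\psi\!\left(\frac{\lambda}{2\sqrt{d-1}}\right).$$
   Context: Graphs are finite, undirected and simple. For a $d$-regular graph $G$ on $n$ vertices, let $d=\lambda_1\geq\lambda_2\geq\dots\geq\lambda_n$ be the eigenvalues of its adjacency matrix. For an integer $d$ and a real $\lambda<d$, an $(n,d,\lambda)$-graph is a $d$-regular graph on $n$ vertices whose second largest eigenvalue in absolute value is $\lambda$, i.e. $\lambda=\max\{\lambda_2,|\lambda_n|\}$ (the condition $\lambda<d$ is equivalent to $G$ being connected and non-bipartite). A non-backtracking random walk of length $k$ on $G$ from a vertex $w_0$ is a uniformly chosen member of the set of sequences $(w_0,w_1,\dots,w_k)$ of vertices with $w_{t-1}w_t\in E$ for all $1\leq t\leq k$ and $w_{t-1}\neq w_{t+1}$ for all $1\leq t\leq k-1$. $\widetilde{P}^{(k)}_{uv}$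 denotes the probability that a non-backtracking random walk of length $k$ on $G$ which starts in $u$ ends in $v$. *)

(* Defs.v *)
From HB Require Import structures.
From mathcomp Require Import all_boot all_order all_algebra.
From mathcomp Require Import polyrcf.
From mathcomp Require Import all_classical all_reals all_analysis.

Set Implicit Arguments.
Unset Strict Implicit.
Unset Printing Implicit Defensive.

Import Order.TTheory GRing.Theory Num.Theory.
Import numFieldNormedType.Exports.

Local Open Scope classical_set_scope.
Local Open Scope ring_scope.

Definition simple_graph (V : finType) (E : rel V) : Prop :=
  symmetric E /\ irreflexive E.

Definition regular_graph (V : finType) (E : rel V) (d : nat) : Prop :=
  forall v : V, #|[pred w | E v w]| = d.

Definition adjacency (R : realType) (V : finType) (E : rel V) : 'M[R]_#|V| :=
  \matrix_(i, j) (E (enum_val i) (enum_val j))%:R.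

(* The real eigenvalues in nonincreasing order, repeated according to their
   multiplicity as roots of the characteristic polynomial; for a symmetric A
   this list has length m. *)
Definition eigenvalues (R : realType) (m : nat) (A : 'M[R]_m) : seq R :=
  sort >=%R (flatten [seq nseq (mup x (char_poly A)) x
                     | x <- rootsR (char_poly A)]).

(* Indexed from 0: graph_eigenvalue R E i is lambda_(i+1). *)
Definition graph_eigenvalue (R : realType) (V : finType) (E : rel V)
  (i : nat) : R := nth 0 (eigenvalues (adjacency R E)) i.

(* The condition 0 < n excludes the empty graph, which is vacuously d-regular
   for every d. *)
Definition ndlambda_graph (R : realType) (V : finType) (E : rel V)
    (n d : nat) (lam : R) : Prop :=
  [/\ simple_graph E, #|V| = n, (0 < n)%N, regular_graph E d
    & lam = Num.max (graph_eigenvalue R E 1) `|graph_eigenvalue R E n.-1|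
      /\ lam < d%:R].

(* The default u of nth is never reached: all indices used are at most k. *)
Definition nb_walks (V : finType) (E : rel V) (k : nat) (u : V) :
    {set k.+1.-tuple V} :=
  [set w : k.+1.-tuple V |
    [&& nth u w 0 == u,
        [forall t : 'I_k, E (nth u w t) (nth u w t.+1)]
      & [forall t : 'I_k.-1, nth u w t != nth u w t.+2]]]%SET.

Definition nb_prob (R : realType) (V : finType) (E : rel V) (k : nat)
    (u v : V) : R :=
  #|[set w in nb_walks E k u | nth u w k == v]%SET|%:R / #|nb_walks E k u|%:R.

(* The maximum is over nonnegative reals, so the unit 0 is harmless; the term
   k = 0 has exponent 0^-1 = 0 and does not affect the limsup. *)
Definition nb_mixing_rate (R : realType) (V : finType) (E : rel V) : \bar R :=
  limn_esup (fun k : nat =>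
    (\big[Num.max/0]_(u : V) \big[Num.max/0]_(v : V)
       (`|nb_prob R E k u v - #|V|%:R^-1| `^ k%:R^-1))%:E).

Definition psi (R : realType) (x : R) : R :=
  if 1 <= x then x + Num.sqrt (x ^+ 2 - 1) else 1.

(* Main.v *)
Require Import Defs.
From HB Require Import structures.
From mathcomp Require Import all_boot all_order all_algebra.
From mathcomp Require Import mxred spectral sesquilinear polyrcf complex.
From mathcomp Require Import ring lra.
From mathcomp Require Import all_classical all_reals all_analysis.

(** Non-backtracking walks of length k are counted by a polynomial in the
    adjacency matrix A: extending a walk by one edge and discarding the
    extensions that turn back gives N_(k+1) = N_k A - (d-1) N_(k-1) for k >= 2
    (with d in place of d-1 when k = 1), so that N_k = p_k(A) for the Geronimus
    polynomials p_k ([nb_matrix_geronimus]).  Diagonalizing A, with its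
    eigenvalues D_i real since A is symmetric, the constant vector carries the
    eigenvalue d and accounts exactly for the term 1/n of the uniform
    distribution; what is left is
      P^(k)_uv - 1/n = sum over the other i of Q_ui (p_k(D_i) / p_k(d)) P_iv,
    where p_k(d) = d (d-1)^(k-1) and P, Q = P^-1 do not depend on k
    ([deviation_spectral], [eigenvalue_deviation]).  The deviation and the
    numbers p_k(D_i) / p_k(d) therefore bound each other up to constants.

    It remains to find the exponential growth rate of k |-> p_k(x) for a fixed
    |x| < d.  Put b = d - 1.  The recurrence has characteristic polynomial
    z^2 - x z + b, whose larger root in modulus has absolute value
    s(x) = sqrt b * psi(|x| / (2 sqrt b)): for |x| <= 2 sqrt b the roots are
    complex conjugates of modulus sqrt b, and otherwise they are real.  That
    p_k(x) grows exactly at the rate s(x) rests on the identity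
      p_(k+2)^2 - x p_(k+2) p_(k+1) + b p_(k+1)^2 = (d^2 - x^2) b^k
    ([geronimus_quadratic_form]), whose right-hand side is positive precisely
    because |x| < d.  In the complex case the left-hand side is a positive
    semidefinite form in two consecutive terms; in the real case it factors as
    (p_(k+2) - r p_(k+1)) (p_(k+2) - t p_(k+1)) with roots r, t, so neither
    exponential can be absent from p_k(x).  Both cases give an upper bound at
    any rate above s(x) ([growth_upper]) and a lower bound at the rate s(x) for
    one of any two consecutive terms ([growth_lower]); the lower bound on pairs
    is what a limsup needs, since p_k(x) can vanish for infinitely many k.

    As s is nondecreasing in |x|, the largest rate among the nontrivial
    eigenvalues is s(lambda), hence the mixing rate is
    s(lambda) / b = psi(lambda / (2 sqrt b)) / sqrt b; it is below 1 because
    s(x) < b for |x| < b + 1 = d ([char_modulus_lt]), which gives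
    convergence. *)

Set Implicit Arguments.
Unset Strict Implicit.
Unset Printing Implicit Defensive.

Import Order.TTheory GRing.Theory Num.Theory.
Import numFieldNormedType.Exports.

Local Open Scope classical_set_scope.
Local Open Scope ring_scope.

(** * The Geronimus polynomials *)

(** The orthogonal polynomials of the d-regular tree: the term of index k
    counts the non-backtracking walks of length k when evaluated at an
    adjacency matrix.  The coefficient d at the first step, instead of d - 1, is
    the number of ways to leave the starting vertex and return at once. *)
Fixpoint geronimus {S : pzRingType} (d x : S) (k : nat) : S :=
  match k with
  | 0 => 1
  | 1 => x
  | (j.+1 as i).+1 =>
      x * geronimus d x i - (if j is 0 then d else d - 1) * geronimus d x j
  end.

Lemma geronimusSSS (S : pzRingType) (d x : S) k :
  geronimus d x k.+3 =
    x * geronimus d x k.+2 - (d - 1) * geronimus d x k.+1.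
Proof. by []. Qed.

(** For any solution of y_(k+2) = x y_(k+1) - b y_k this quadratic form in two
    consecutive terms is multiplied by b at each step; its value
    d^2 - x^2 at the start is what ties nondegeneracy to |x| < d. *)
Lemma geronimus_quadratic_form (S : comPzRingType) (d x : S) k :
  geronimus d x k.+2 ^+ 2 - x * geronimus d x k.+2 * geronimus d x k.+1
    + (d - 1) * geronimus d x k.+1 ^+ 2 = (d ^+ 2 - x ^+ 2) * (d - 1) ^+ k.
Proof.
elim: k => [|k IH]; first by rewrite /= expr0; ring.
by rewrite geronimusSSS (exprSr _ k) mulrA -IH; ring.
Qed.

Lemma geronimus_degree (S : comPzRingType) (d : S) k :
  geronimus d d k.+1 = d * (d - 1) ^+ k.
Proof.
suff [] : geronimus d d k.+1 = d * (d - 1) ^+ k /\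
    geronimus d d k.+2 = d * (d - 1) ^+ k.+1 by [].
elim: k => [|k [IH1 IH2]]; first by split=> /=; ring.
by split=> //; rewrite geronimusSSS IH1 IH2 !exprS; ring.
Qed.

(** * The larger root of z^2 - x z + b *)

Section Psi.
Variable R : realType.
Implicit Types (b x y s : R).

Lemma psi_ge1 x : 1 <= psi x.
Proof.
rewrite /psi; case: ifP => // x1.
by rewrite (le_trans x1)// lerDl sqrtr_ge0.
Qed.

Lemma psi_homo x y : x <= y -> psi x <= psi y.
Proof.
move=> xy; have [x1|x1] := leP 1 x; last by rewrite {1}/psi (lt_geF x1) psi_ge1.
rewrite /psi x1 (le_trans x1 xy) lerD// ler_wsqrtr// lerB// lerXn2r// nnegrE; lra.
Qed.

Lemma psi_le1 x : x <= 1 -> psi x = 1.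
Proof.
rewrite /psi le_eqVlt => /predU1P[->|x1]; last by rewrite lt_geF.
by rewrite lexx expr1n subrr sqrtr0 addr0.
Qed.

Lemma psi_quadratic x : 1 <= x -> psi x ^+ 2 - 2 * x * psi x + 1 = 0.
Proof.
move=> x1; rewrite /psi x1.
have : Num.sqrt (x ^+ 2 - 1) ^+ 2 = x ^+ 2 - 1 by rewrite sqr_sqrtr//; nra.
by move=> h; ring: h.
Qed.

(** The largest modulus of a complex root of z^2 - x z + b, for b > 0. *)
Definition char_modulus b x := Num.sqrt b * psi (`|x| / (2 * Num.sqrt b)).

Lemma char_modulus_ge b x : Num.sqrt b <= char_modulus b x.
Proof. by rewrite ler_peMr ?sqrtr_ge0 ?psi_ge1. Qed.

Lemma char_modulus_homo b x y :
  `|x| <= `|y| -> char_modulus b x <= char_modulus b y.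
Proof.
by move=> xy; rewrite ler_wpM2l ?sqrtr_ge0 ?psi_homo// ler_wpM2r// invr_ge0.
Qed.

(** For a nonpositive discriminant the two roots are conjugate, with product
    b. *)
Lemma char_modulus_elliptic b x : 0 < b -> x ^+ 2 <= 4 * b ->
  char_modulus b x = Num.sqrt b.
Proof.
move=> b0 xb; rewrite /char_modulus psi_le1 ?mulr1//.
have w0 : 0 < Num.sqrt b by rewrite sqrtr_gt0.
rewrite ler_pdivrMr ?mulr_gt0// mul1r -(@ler_pXn2r _ 2)// ?nnegrE ?mulr_ge0 ?(ltW w0)//.
by rewrite exprMn sqr_sqrtr ?(ltW b0)// real_normK ?num_real//; lra.
Qed.

Lemma char_modulus_hyperbolic b x : 0 < b -> 4 * b <= x ^+ 2 ->
  char_modulus b x ^+ 2 + b = `|x| * char_modulus b x.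
Proof.
move=> b0 xb; rewrite /char_modulus.
have w0 : 0 < Num.sqrt b by rewrite sqrtr_gt0.
have w2 : Num.sqrt b ^+ 2 = b by rewrite sqr_sqrtr// ltW.
set w := Num.sqrt b in w0 w2 *; set y := `|x| / (2 * w).
have xE : `|x| = 2 * w * y by rewrite /y; field; lra.
have /psi_quadratic : 1 <= y.
  rewrite ler_pdivlMr ?mulr_gt0// mul1r -(@ler_pXn2r _ 2)// ?nnegrE ?mulr_ge0 ?(ltW w0)//.
  by rewrite exprMn w2 real_normK ?num_real//; lra.
set p := psi y => h; rewrite -w2 xE.
apply/eqP; rewrite -subr_eq0 -(mulr0 (w ^+ 2)) -h; apply/eqP; ring.
Qed.

(** In the real case the root s satisfies (s - 1)(s - b) = (|x| - b - 1) s < 0,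
    which places it strictly between 1 and b. *)
Lemma char_modulus_lt b x : 1 < b -> `|x| < b + 1 -> char_modulus b x < b.
Proof.
move=> b1 xb; have b0 : 0 < b by lra.
have w2 : Num.sqrt b ^+ 2 = b by rewrite sqr_sqrtr// ltW.
have w1 : 1 < Num.sqrt b by rewrite -sqrtr1 ltr_sqrt.
have [h|h] := leP (x ^+ 2) (4 * b).
  by rewrite char_modulus_elliptic// -[ltRHS]w2; nra.
have := char_modulus_hyperbolic b0 (ltW h).
have := char_modulus_ge b x; move: (char_modulus b x) => s ws sE.
rewrite ltNge; apply/negP => bs.
have : 0 <= (s - 1) * (s - b) by rewrite mulr_ge0//; lra.
nra.
Qed.

End Psi.

(** * Growth of the solutions of the recurrence *)

Section Growth.
Variable R : realType.
Variables (b x c : R) (p : nat -> R).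
Hypothesis b_gt0 : 0 < b.
Hypothesis c_gt0 : 0 < c.
Hypothesis p_rec : forall k, p k.+2 = x * p k.+1 - b * p k.
Hypothesis p_form : forall k,
  p k.+1 ^+ 2 - x * p k.+1 * p k + b * p k ^+ 2 = c * b ^+ k.
Local Notation s := (char_modulus b x).

(** Subtracting one characteristic root leaves a geometric sequence with the
    other one as ratio. *)
Lemma geom_split r t : r + t = x -> r * t = b ->
  forall k, p k.+1 - t * p k = r ^+ k * (p 1 - t * p 0).
Proof.
move=> xE bE; elim=> [|k IH]; first by rewrite expr0 mul1r.
by rewrite exprS -mulrA -IH p_rec -xE -bE; ring.
Qed.

Lemma char_modulus_gt0 : 0 < s.
Proof. by rewrite (lt_le_trans _ (char_modulus_ge b x))// sqrtr_gt0. Qed.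

(** The dominant root r carries the sign of x. *)
Lemma hyperbolic_roots : 4 * b <= x ^+ 2 -> exists r t : R,
  [/\ r + t = x, r * t = b, `|r| = s & `|t| <= s].
Proof.
move=> h; have sE := char_modulus_hyperbolic b_gt0 h.
have s0 := char_modulus_gt0.
have sb : b <= s ^+ 2.
  rewrite -[leLHS]sqr_sqrtr ?(ltW b_gt0)// lerXn2r ?char_modulus_ge//.
    by rewrite nnegrE sqrtr_ge0.
  by rewrite nnegrE ltW.
have bs : `|b / s| <= s.
  by rewrite gtr0_norm ?divr_gt0// ler_pdivrMr// -expr2.
have ss : `|x| = s + b / s by apply: (mulIf (lt0r_neq0 s0)); rewrite -sE; field; lra.
have [x0|x0] := leP 0 x.
  exists s, (b / s); split=> //; last by rewrite gtr0_norm.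
    by rewrite -ss ger0_norm.
  by field; lra.
exists (- s), (- (b / s)); split; last by rewrite normrN.
- by rewrite -opprD -ss ltr0_norm// opprK.
- by field; lra.
- by rewrite normrN gtr0_norm.
Qed.

(** In the complex case completing the square in the invariant form gives
    (p_(k+1) - x p_k / 2)^2 <= c b^k, where |x| / 2 <= sqrt b; in the real case
    the same shape of bound comes from the split along the smaller root. *)
Lemma growth_step :
  exists2 K : R, 0 <= K & forall k, `|p k.+1| <= s * `|p k| + K * s ^+ k.
Proof.
have s0 := char_modulus_gt0.
have [h|/ltW h] := leP (x ^+ 2) (4 * b).
  have sE := char_modulus_elliptic b_gt0 h.
  have s2 : s ^+ 2 = b by rewrite sE sqr_sqrtr// ltW.
  exists (Num.sqrt c) => [|k]; first exact: sqrtr_ge0.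
  have xs : `|x / 2| <= s.
    rewrite -(@ler_pXn2r _ 2)// ?nnegrE ?(ltW s0)//.
    by rewrite real_normK ?num_real// s2 expr_div_n; lra.
  have : `|p k.+1 - x / 2 * p k| <= Num.sqrt c * s ^+ k.
    rewrite -(@ler_pXn2r _ 2)// ?nnegrE ?mulr_ge0 ?sqrtr_ge0 ?exprn_ge0 ?(ltW s0)//.
    rewrite real_normK ?num_real// exprMn sqr_sqrtr ?(ltW c_gt0)//.
    rewrite -exprM mulnC exprM s2 -p_form.
    have := sqr_ge0 (p k); set q := p k; set q' := p k.+1 => q0.
    have : 0 <= (4 * b - x ^+ 2) * q ^+ 2 by rewrite mulr_ge0// subr_ge0.
    by lra.
  move=> h1; rewrite -[p k.+1](subrK (x / 2 * p k)) addrC.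
  rewrite (le_trans (ler_normD _ _))// lerD// normrM ler_wpM2r//.
have [r [t [xE bE rs ts]]] := hyperbolic_roots h.
exists `|p 1 - t * p 0| => // k; rewrite -[p k.+1](subrK (t * p k)) addrC.
rewrite (le_trans (ler_normD _ _))// lerD//.
  by rewrite normrM ler_wpM2r.
by rewrite (geom_split xE bE k) normrM normrX rs mulrC.
Qed.

(** The one-step inequality alone allows a factor linear in k, which does occur
    for a double root; any s' > s absorbs it. *)
Lemma growth_upper s' : s < s' ->
  exists2 L : R, 0 <= L & forall k, `|p k| <= L * s' ^+ k.
Proof.
move=> ss'; have s0 := char_modulus_gt0.
have [K K0 hK] := growth_step.
have L0 : 0 <= K / (s' - s) by rewrite divr_ge0// subr_ge0 ltW.
exists (K / (s' - s) + `|p 0|); first by rewrite addr_ge0.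
elim=> [|k IH]; first by rewrite expr0 mulr1 lerDr.
apply: (le_trans (hK k)); rewrite exprS.
have sk : s ^+ k <= s' ^+ k by rewrite lerXn2r ?nnegrE//; lra.
have s'k : 0 <= s' ^+ k by rewrite exprn_ge0//; lra.
have KE : K = K / (s' - s) * (s' - s) by rewrite divfK//; lra.
move: (K / (s' - s)) L0 KE IH => M M0 -> IH.
have h1 := ler_wpM2l (ltW s0) IH.
have h2 : M * (s' - s) * s ^+ k <= M * (s' - s) * s' ^+ k.
  by rewrite ler_wpM2l// mulr_ge0//; lra.
have h3 : 0 <= `|p 0| * (s' - s) * s' ^+ k.
  by rewrite !mulr_ge0//; lra.
nra.
Qed.

(** Two consecutive terms cannot both be small: in the complex case because the
    quadratic form in them equals c b^k = c s^(2k), in the real case because the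
    component along the dominant root is nonzero, as its product with the
    component along the other root is the form at index 0. *)
Lemma growth_lower :
  exists2 C : R, 0 < C & forall k, C * s ^+ k <= `|p k.+1| + `|p k|.
Proof.
have s0 := char_modulus_gt0.
have [h|/ltW h] := leP (x ^+ 2) (4 * b).
  have sE := char_modulus_elliptic b_gt0 h.
  have s2 : s ^+ 2 = b by rewrite sE sqr_sqrtr// ltW.
  (* M bounds the sum of the absolute values of the coefficients of the form. *)
  pose M := 1 + `|x| + b.
  have M0 : 0 < M by rewrite /M -addrA ltr_wpDr// addr_ge0// ltW.
  exists (Num.sqrt (c / M)) => [|k]; first by rewrite sqrtr_gt0 divr_gt0.
  rewrite -(@ler_pXn2r _ 2)// ?nnegrE ?addr_ge0 ?mulr_ge0 ?sqrtr_ge0 ?exprn_ge0 ?(ltW s0)//.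
  rewrite exprMn sqr_sqrtr ?divr_ge0 ?(ltW c_gt0) ?(ltW M0)//.
  rewrite -exprM mulnC exprM s2 mulrAC ler_pdivrMr// -p_form.
  have := ler_norm (- (x * p k.+1 * p k)); rewrite normrN !normrM.
  rewrite -[p k.+1 ^+ 2]real_normK ?num_real// -[p k ^+ 2]real_normK ?num_real//.
  move=> h1.
  have := normr_ge0 (p k.+1); have := normr_ge0 (p k); have := normr_ge0 x.
  move: `|x| `|p k| `|p k.+1| @M M0 h1 => y q q' M M0 h1 y0 q0 q'0.
  have qq : 0 <= q * q' by rewrite mulr_ge0.
  have : 0 <= y * (q ^+ 2 + q' ^+ 2 + q * q').
    by rewrite mulr_ge0// !addr_ge0// sqr_ge0.
  have : 0 <= b * (q' ^+ 2 + 2 * (q * q')).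
    by rewrite mulr_ge0 ?(ltW b_gt0)// addr_ge0 ?sqr_ge0 ?mulr_ge0.
  have := sqr_ge0 q; rewrite /M; nra.
have [r [t [xE bE rs ts]]] := hyperbolic_roots h.
have a0 : p 1 - t * p 0 != 0.
  apply/eqP => a0; have := p_form 0; rewrite expr0 mulr1 => cE.
  suff c0 : c = 0 by move: c_gt0; rewrite c0 ltxx.
  by rewrite -cE -(mul0r (p 1 - r * p 0)) -a0 -xE -bE; ring.
exists (`|p 1 - t * p 0| / (1 + s)) => [|k].
  by rewrite divr_gt0 ?normr_gt0//; lra.
rewrite mulrAC ler_pdivrMr; last by lra.
have := congr1 Num.norm (geom_split xE bE k).
rewrite [RHS]normrM normrX rs [RHS]mulrC => <-.
have := ler_normB (p k.+1) (t * p k); rewrite normrM.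
have := ler_wpM2r (normr_ge0 (p k)) ts.
have := normr_ge0 (p k); have := normr_ge0 (p k.+1).
have := mulr_ge0 (ltW s0) (normr_ge0 (p k.+1)).
nra.
Qed.

End Growth.

(** * Counting non-backtracking walks *)

Section Counting.
Variables (V : finType) (E : rel V).
Implicit Types (u v x y z : V) (k : nat).

Definition nb_count k u v : nat :=
  #|[set w in nb_walks E k u | nth u w k == v]%SET|.

(** Refining the count by the last two vertices is what makes it recursive: the
    non-backtracking condition on a further step only sees these two. *)
Definition nb_count2 k u x y : nat :=
  #|[set w in nb_walks E k.+1 u | (nth u w k == x) && (nth u w k.+1 == y)]%SET|.

Lemma nb_walksP k u (w : k.+1.-tuple V) :
  reflect [/\ nth u w 0 = u,
              forall t, (t < k)%N -> E (nth u w t) (nth u w t.+1)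
            & forall t, (t.+1 < k)%N -> nth u w t != nth u w t.+2]
          (w \in nb_walks E k u).
Proof.
rewrite inE; apply: (iffP and3P) => -[w0 wE wN].
  split=> [|t tk|t tk]; first exact/eqP.
    exact: (forallP wE (Ordinal tk)).
  have tk' : (t < k.-1)%N by rewrite ltn_predRL.
  exact: (forallP wN (Ordinal tk')).
split; first exact/eqP.
  by apply/forallP => t; apply: wE.
by apply/forallP => -[t /= tk]; apply: wN; rewrite -ltn_predRL.
Qed.

Lemma nb_walks_rcons k u (w : k.+1.-tuple V) z :
  ([tuple of rcons w z] \in nb_walks E k.+1 u) =
  [&& w \in nb_walks E k u, E (nth u w k) z
    & (0 < k)%N ==> (nth u w k.-1 != z)].
Proof.
have nthw t : (t < k.+1)%N -> nth u (rcons w z) t = nth u w t.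
  by move=> tk; rewrite nth_rcons size_tuple tk.
have nthz : nth u (rcons w z) k.+1 = z.
  by rewrite nth_rcons size_tuple ltnn eqxx.
apply/nb_walksP/and3P => /= [[w0 wE wN]|[/nb_walksP[w0 wE wN] Ez Nz]].
  split.
  - apply/nb_walksP; split=> [|t tk|t tk].
    + by rewrite -nthw.
    + by rewrite -!nthw ?ltnS//; [exact: wE (ltnW _) | exact: ltnW].
    + rewrite -!nthw ?ltnS//; last exact: ltnW (ltnW _).
      by apply: wN; exact: ltnW.
  - by rewrite -[X in E _ X]nthz -(nthw k)//; apply: wE.
  - apply/implyP => k0; rewrite -nthz -nthw ?ltnS ?leq_pred//.
    by have := wN k.-1; rewrite prednK//; apply.
split=> [|t|t].
- by rewrite nthw.
- rewrite ltnS leq_eqVlt => /predU1P[->|tk]; first by rewrite nthz nthw.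
  by rewrite !nthw ?ltnS//; [exact: wE | exact: ltnW].
- rewrite ltnS leq_eqVlt => /predU1P[[tk]|tk].
    have k0 : (0 < k)%N by rewrite -tk.
    have -> : t = k.-1 by rewrite -tk.
    by rewrite (prednK k0) nthz nthw ?ltnS ?leq_pred//; apply: (implyP Nz).
  rewrite !nthw ?ltnS//; first exact: wN.
  exact: ltnW (ltnW _).
Qed.

Lemma nb_count0 u v : nb_count 0 u v = (u == v).
Proof.
rewrite /nb_count; case: eqVneq => [<-|uv].
  rewrite (_ : [set _ in _ | _]%SET = [set [tuple u]]%SET) ?cards1//.
  apply/setP => w; rewrite !inE; case/tupleP: w => a w; rewrite tuple0 /=.
  apply/idP/eqP => [/andP[_ /eqP ->]|/(congr1 (fun w : 1.-tuple V => thead w))].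
    exact/val_inj.
  rewrite !theadE => ->; rewrite eqxx /= andbT; apply/andP; split; apply/forallP.
    by case.
  by case.
apply/eqP; rewrite cards_eq0; apply/eqP/setP => w; rewrite !inE.
by apply/negP => /andP[/and3P[/eqP-> _ _]]; rewrite (negbTE uv).
Qed.

Lemma nb_count_last2 k u y : nb_count k.+1 u y = (\sum_x nb_count2 k u x y)%N.
Proof.
rewrite /nb_count -sum1_card (partition_big (fun w : k.+2.-tuple V => nth u w k) predT)//=.
apply: eq_bigr => x _; rewrite /nb_count2 -sum1_card; apply: eq_bigl => w.
by rewrite !inE -!andbA; congr [&& _, _, _ & _]; rewrite andbC.
Qed.

Lemma nb_count2_0 u x y : nb_count2 0 u x y = ((x == u) && E x y).
Proof.
have walkE w : (w \in nb_walks E 1 u) && ((nth u w 0 == x) && (nth u w 1 == y))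
    = [&& x == u, E x y & w == [tuple x; y]].
  case/tupleP: w => a w; case/tupleP: w => b w; rewrite tuple0 /=.
  have -> : ([tuple a; b] == [tuple x; y]) = (a == x) && (b == y).
    by rewrite -val_eqE /= !eqseq_cons andbT.
  case: (eqVneq a x) => [<-|]; last by rewrite !andbF.
  case: (eqVneq b y) => [<-|]; last by rewrite !andbF.
  rewrite !andbT; apply/nb_walksP/andP => /= [[-> wE _]|[/eqP <- Eab]].
    by split=> //; exact: wE 0 _.
  by split=> // -[].
rewrite /nb_count2; case: (boolP ((x == u) && E x y)) => [/andP[xu Exy]|xyN].
  rewrite (_ : [set _ in _ | _]%SET = [set [tuple x; y]]%SET) ?cards1//.
  by apply/setP => w; rewrite [LHS]finset.in_set walkE xu Exy finset.in_set1.
apply/eqP; rewrite cards_eq0; apply/eqP/setP => w.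
by rewrite [LHS]finset.in_set walkE andbA (negbTE xyN) finset.in_set0.
Qed.

Lemma rcons_tupleP (T : Type) m (w : m.+1.-tuple T) :
  exists (w' : m.-tuple T) (x : T), w = [tuple of rcons w' x].
Proof.
case: w => s; case/lastP: s => [//|s x] sz.
have sz' : size s == m by move: sz; rewrite size_rcons.
by exists (Tuple sz'), x; exact: val_inj.
Qed.

Lemma nb_count2S k u y z :
  nb_count2 k.+1 u y z =
  (E y z * #|[set w in nb_walks E k.+1 u |
                (nth u w k.+1 == y) && (nth u w k != z)]%SET|)%N.
Proof.
have mem_rcons (w : k.+2.-tuple V) x :
  ([tuple of rcons w x] \in [set w in nb_walks E k.+2 u |
      (nth u w k.+1 == y) && (nth u w k.+2 == z)]%SET) =
  [&& x == z, E y z & w \in [set w in nb_walks E k.+1 u |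
      (nth u w k.+1 == y) && (nth u w k != z)]%SET].
  rewrite [LHS]finset.in_set [in RHS]finset.in_set nb_walks_rcons /= !nth_rcons !size_tuple ltnSn ltnn eqxx.
  case: (eqVneq x z) => [->|_]; last by rewrite !andbF.
  case: (eqVneq (nth u w k.+1) y) => [->|_]; last by rewrite !andbF.
  by rewrite !andbT /= andbCA.
rewrite /nb_count2; set B := [set w in nb_walks E k.+1 u | _]%SET in mem_rcons *.
case: (boolP (E y z)) => [Eyz|Nyz]; rewrite ?mul1n ?mul0n; last first.
  apply/eqP; rewrite cards_eq0; apply/eqP/setP => w.
  have [w' [x ->]] := rcons_tupleP w.
  by rewrite mem_rcons (negbTE Nyz) andbF finset.in_set0.
pose f (w : k.+2.-tuple V) : k.+3.-tuple V := [tuple of rcons w z].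
have f_inj : injective f by move=> w1 w2 /(congr1 val)/rcons_inj[] /val_inj.
rewrite -(card_imset _ f_inj); congr #|pred_of_set _|.
apply/setP => w; have [w' [x ->]] := rcons_tupleP w.
rewrite mem_rcons Eyz; apply/andP/imsetP => [[/eqP -> w'B]|[w1 w1B]].
  by exists w'.
by move/(congr1 val)/rcons_inj => [/val_inj-> ->].
Qed.

Lemma nb_count_split k u y z :
  nb_count k.+1 u y =
  (#|[set w in nb_walks E k.+1 u |
        (nth u w k.+1 == y) && (nth u w k != z)]%SET| + nb_count2 k u z y)%N.
Proof.
rewrite /nb_count /nb_count2 -(cardsID [set w : k.+2.-tuple V | nth u w k == z]%SET).
rewrite addnC; congr (_ + _)%N; apply: eq_card => w; rewrite !inE.
  by rewrite andbC -!andbA.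
by rewrite -!andbA; do !bool_congr; rewrite andbC.
Qed.

Lemma card_nb_walks k u : #|nb_walks E k u| = (\sum_v nb_count k u v)%N.
Proof.
rewrite -sum1_card (partition_big (fun w : k.+1.-tuple V => nth u w k) predT)//=.
apply: eq_bigr => v _; rewrite /nb_count -sum1_card; apply: eq_bigl => w.
by rewrite [RHS]finset.in_set.
Qed.

Lemma nb_count1 u v : nb_count 1 u v = E u v.
Proof.
rewrite nb_count_last2 (bigD1 u)//= big1 ?addn0 ?nb_count2_0 ?eqxx// => x xu.
by rewrite nb_count2_0 (negbTE xu).
Qed.

(** The last two vertices of a counted walk are adjacent. *)
Lemma nb_count2_edge k u y z : (E y z * nb_count2 k u y z)%N = nb_count2 k u y z.
Proof.
case: k => [|k]; last by rewrite nb_count2S mulnA mulnb andbb.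
by rewrite nb_count2_0 mulnb andbCA andbb.
Qed.

(** Extending by every edge at the end vertex overcounts by the extensions that
    return to the vertex visited just before. *)
Lemma nb_count_step k u z :
  (\sum_y E y z * nb_count k.+1 u y =
   nb_count k.+2 u z + \sum_y E y z * nb_count2 k u z y)%N.
Proof.
rewrite nb_count_last2 -big_split /=; apply: eq_bigr => y _.
by rewrite nb_count2S (nb_count_split k u y z) mulnDr.
Qed.

Variable d : nat.
Hypothesis E_graph : simple_graph E.
Hypothesis E_regular : regular_graph E d.

Lemma regular_degree z : (\sum_y E y z = d)%N.
Proof.
rewrite -(E_regular z) -sum1_card [RHS]big_mkcond /=; apply: eq_bigr => y _.
by rewrite inE E_graph.1; case: (E y z).
Qed.

(** At the second step the walks that turn back are those returning to their
    start, one for each of the d edges there. *)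
Lemma nb_count_rec0 u z :
  (\sum_y E y z * nb_count 1 u y = nb_count 2 u z + d * nb_count 0 u z)%N.
Proof.
rewrite nb_count_step nb_count0; congr addn.
rewrite -(regular_degree z) big_distrl /=; apply: eq_bigr => y _.
rewrite nb_count2_0 (E_graph.1 z y) (eq_sym z u).
by case: (E y z); case: (u == z); rewrite ?andbF ?muln0.
Qed.

(** A walk of length k+2 that is about to turn back to z is a walk of length k+1
    ending in z followed by one of the d - 1 edges at z that it did not arrive
    by; this is stated with the arrival edge moved to the left, to stay free of
    truncated subtraction. *)
Lemma nb_count_rec k u z :
  (\sum_y E y z * nb_count k.+2 u y + nb_count k.+1 u z =
   nb_count k.+3 u z + d * nb_count k.+1 u z)%N.
Proof.
rewrite nb_count_step -addnA; congr addn.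
rewrite {1}nb_count_last2 -big_split -(regular_degree z) big_distrl /=.
apply: eq_bigr => y _; rewrite (nb_count_split k u z y) mulnDr nb_count2_edge.
by rewrite nb_count2S (E_graph.1 z y) mulnA mulnb andbb.
Qed.

Variable R : realType.

Definition nb_matrix k : 'M[R]_#|V| :=
  \matrix_(i, j) (nb_count k (enum_val i) (enum_val j))%:R.

Lemma adjacency_sym : (adjacency R E)^T = adjacency R E.
Proof. by apply/matrixP => i j; rewrite !mxE E_graph.1. Qed.

Lemma nb_matrix_mulA k i j :
  (nb_matrix k *m adjacency R E) i j =
  (\sum_y E y (enum_val j) * nb_count k (enum_val i) y)%N%:R.
Proof.
rewrite mxE (reindex (@enum_val V predT)) /=; last first.
  by apply: onW_bij; exact: enum_val_bij.
rewrite natr_sum; apply: eq_bigr => l _.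
by rewrite !mxE natrM mulrC.
Qed.

Lemma nb_matrix0 : nb_matrix 0 = 1%:M.
Proof.
by apply/matrixP => i j; rewrite !mxE nb_count0 (inj_eq enum_val_inj).
Qed.

Lemma nb_matrix1 : nb_matrix 1 = adjacency R E.
Proof. by apply/matrixP => i j; rewrite !mxE nb_count1. Qed.

Lemma nb_matrix2 :
  nb_matrix 2 = nb_matrix 1 *m adjacency R E - d%:R *: nb_matrix 0.
Proof.
apply/matrixP => i j; rewrite [RHS]mxE [X in _ + X]mxE [X in _ - X]mxE.
by rewrite nb_matrix_mulA nb_count_rec0 !mxE natrD natrM addrK.
Qed.

Lemma nb_matrix_rec k :
  nb_matrix k.+3 =
  nb_matrix k.+2 *m adjacency R E - (d%:R - 1) *: nb_matrix k.+1.
Proof.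
apply/matrixP => i j; rewrite [RHS]mxE [X in _ + X]mxE [X in _ - X]mxE.
rewrite nb_matrix_mulA; have := nb_count_rec k (enum_val i) (enum_val j).
move/(congr1 (fun n : nat => n%:R : R)); rewrite !natrD natrM !mxE => h.
lra.
Qed.

(** Evaluating p_k at A on a family of eigenvectors; a full eigenbasis
    gives the spectral decomposition of N_k, and the single constant vector
    gives the total number of walks. *)
Lemma nb_matrix_geronimus r (Q : 'M[R]_(#|V|, r)) (D : 'rV[R]_r) k :
  adjacency R E *m Q = Q *m diag_mx D ->
  nb_matrix k *m Q =
    Q *m diag_mx (\row_i geronimus (d%:R : R) (D ord0 i) k).
Proof.
move=> AQ.
have step j : nb_matrix j *m Q =
      Q *m diag_mx (\row_i geronimus (d%:R : R) (D ord0 i) j) ->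
    nb_matrix j *m adjacency R E *m Q =
      Q *m diag_mx (\row_i (D ord0 i * geronimus (d%:R : R) (D ord0 i) j)).
  move=> jQ; rewrite -mulmxA AQ mulmxA jQ -mulmxA mulmx_diag; congr (_ *m diag_mx _).
  by apply/rowP => i; rewrite !mxE mulrC.
suff [] : nb_matrix k.+1 *m Q =
      Q *m diag_mx (\row_i geronimus (d%:R : R) (D ord0 i) k.+1) /\ nb_matrix k *m Q =
      Q *m diag_mx (\row_i geronimus (d%:R : R) (D ord0 i) k) by [].
elim: k => [|[|k] [IH1 IH2]].
- rewrite nb_matrix1 nb_matrix0 AQ mul1mx; split.
    by congr (_ *m diag_mx _); apply/rowP => i; rewrite !mxE.
  rewrite (_ : \row_i _ = const_mx 1) ?diag_const_mx ?mulmx1//.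
  by apply/rowP => i; rewrite !mxE.
- split=> //; rewrite nb_matrix2 mulmxBl -scalemxAl step// IH2 scalemxAr -mulmxBr.
  rewrite -linearZ -linearB /=; congr (_ *m diag_mx _).
  by apply/rowP => i; rewrite !mxE.
- split=> //; rewrite nb_matrix_rec mulmxBl -scalemxAl step// IH2 scalemxAr -mulmxBr.
  rewrite -linearZ -linearB /=; congr (_ *m diag_mx _).
  by apply/rowP => i; rewrite !mxE.
Qed.

Lemma adjacency_mul1 :
  adjacency R E *m (const_mx 1 : 'cV_#|V|) = const_mx 1 *m diag_mx (const_mx d%:R).
Proof.
rewrite diag_const_mx mul_mx_scalar; apply/matrixP => i j; rewrite !mxE mulr1.
rewrite -(regular_degree (enum_val i)) (reindex (@enum_val V predT)) /=; last first.
  by apply: onW_bij; exact: enum_val_bij.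
by rewrite natr_sum; apply: eq_bigr => l _; rewrite !mxE mulr1 E_graph.1.
Qed.

Lemma card_nb_walks_regular k u :
  #|nb_walks E k.+1 u|%:R = d%:R * (d%:R - 1) ^+ k :> R.
Proof.
have /matrixP/(_ (enum_rank u) ord0) := nb_matrix_geronimus k.+1 adjacency_mul1.
rewrite mul_mx_diag !mxE geronimus_degree mul1r => <-.
rewrite card_nb_walks (reindex (@enum_val V predT)) /=; last first.
  by apply: onW_bij; exact: enum_val_bij.
by rewrite natr_sum; apply: eq_bigr => l _; rewrite !mxE mulr1 enum_rankK.
Qed.

End Counting.

(** * The spectrum of a real symmetric matrix *)

Lemma realmx_complexP (R : rcfType) k l (A : 'M[R[i]]_(k, l)) :
  A \is a realmx -> exists B : 'M[R]_(k, l), A = map_mx (real_complex R) B.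
Proof.
move=> Areal; exists (map_mx (@complex.Re R) A); apply/matrixP => i j.
by rewrite !mxE RRe_real//; exact: (mxOverP Areal).
Qed.

(** Over R[i] a symmetric real matrix is Hermitian, hence unitarily
    diagonalizable with real eigenvalues; two real matrices that are similar over
    R[i] are already similar over R. *)
Lemma real_symmetric_diagonalizable (R : rcfType) m (A : 'M[R]_m) :
  A^T = A -> exists (P : 'M[R]_m) (D : 'rV[R]_m),
    P \in unitmx /\ P *m A = diag_mx D *m P.
Proof.
move=> Asym; pose c := real_complex R; pose AC := map_mx c A.
have real_map k l (B : 'M[R]_(k, l)) : map_mx c B \is a realmx.
  by apply/mxOverP => i j; rewrite mxE; apply/complex_realP; eexists.
have AC_sym : AC \is symmetricmx.
  by apply/is_hermitianmxP; rewrite expr0 scale1r map_trmx Asym map_mx_id.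
have AC_herm := realsym_hermsym AC_sym (real_map _ _ A).
have D_real := hermitian_spectral_diag_real AC_herm.
have [D DE] := realmx_complexP D_real.
have /orthomx_spectralP ACE := hermitian_normalmx AC_herm.
have [] := @real_similar _ _ AC (map_mx c (diag_mx D)).
- exists (spectralmx AC); first exact: spectral_unit.
  apply/similarP; first exact: spectral_unit.
  rewrite map_diag_mx -DE {2}ACE !mulmxA mulmxV ?mul1mx//.
  exact: spectral_unit.
- exact: real_map.
- exact: real_map.
move=> PC /andP[/realmx_complexP [P ->]]; rewrite map_unitmx => Pu.
move=> /similarP; rewrite map_unitmx => /(_ Pu).
rewrite /AC -!map_mxM => /matrixP PA.
exists P, D; split=> //; apply/matrixP => i j.
by have := PA i j; rewrite !mxE => /complexI.
Qed.

Lemma char_poly_conj (F : fieldType) m (P A B : 'M[F]_m) :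
  P \in unitmx -> P *m A = B *m P -> char_poly A = char_poly B.
Proof.
move=> Pu PA; have dP : \det (map_mx polyC P) != 0.
  by rewrite det_map_mx polyC_eq0 -unitfE -unitmxE.
apply: (mulfI dP); rewrite /char_poly -det_mulmx [RHS]mulrC -det_mulmx.
congr (\det _); rewrite /char_poly_mx mulmxBr mulmxBl -!map_mxM PA.
by rewrite scalar_mxC.
Qed.

Lemma mup_prod_XsubC (F : fieldType) (s : seq F) (x : F) :
  mup x (\prod_(y <- s) ('X - y%:P)) = count_mem x s.
Proof.
elim: s => [|y s IH]; first by rewrite big_nil mupNroot// rootE hornerC oner_eq0.
rewrite big_cons mupM ?polyXsubC_eq0//; last first.
  by rewrite monic_neq0// monic_prod_XsubC.
by rewrite IH -[X in mup _ X]expr1 mup_XsubCX.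
Qed.

(** Compare the multiplicities of each value; a value outside the list of real
    roots has multiplicity 0 in the polynomial, hence does not occur in s. *)
Lemma perm_eigenvalues (R : realType) m (A : 'M[R]_m) (s : seq R) :
  char_poly A = \prod_(x <- s) ('X - x%:P) -> perm_eq (eigenvalues A) s.
Proof.
move=> As; rewrite /eigenvalues perm_sort; apply/allP => x _ /=.
have p0 : char_poly A != 0 by rewrite monic_neq0// char_poly_monic.
have uniq_rts : uniq (rootsR (char_poly A)).
  exact: uniq_roots.
rewrite count_flatten -map_comp -mup_prod_XsubC -As; apply/eqP.
rewrite (eq_map (g := fun y => (x == y) * mup y (char_poly A))%N); last first.
  by move=> y /=; rewrite count_nseq /= eq_sym.
rewrite sumnE big_map; have [xr|xr] := boolP (x \in rootsR (char_poly A)).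
  rewrite (bigD1_seq x)//= eqxx mul1n big1 ?addn0// => y.
  by rewrite eq_sym => /negbTE->.
rewrite big1_seq => [|y /andP[_ yr]]; last first.
  by rewrite (_ : x == y = false)//; apply: contraNF xr => /eqP->.
rewrite mupNroot//; apply: contra xr => xroot.
by rewrite -(roots_on_rootsR p0) xroot in_itv.
Qed.

Lemma symmetric_spectrum (R : realType) m (A : 'M[R]_m) :
  A^T = A -> exists (P Q : 'M[R]_m) (D : 'rV[R]_m),
    [/\ P *m Q = 1%:M, Q *m P = 1%:M, P *m A = diag_mx D *m P,
        A *m Q = Q *m diag_mx D
      & perm_eq (eigenvalues A) [seq D ord0 i | i <- enum 'I_m]].
Proof.
move=> /real_symmetric_diagonalizable[P [D [Pu PA]]].
exists P, (invmx P), D; split=> //.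
- by rewrite mulmxV.
- by rewrite mulVmx.
- by rewrite -[A](mulKmx Pu) PA !mulmxA mulmxK.
apply: perm_eigenvalues; rewrite (char_poly_conj Pu PA) char_poly_trig ?diag_mx_is_trig//.
rewrite big_map enumT; apply: eq_bigr => i _.
by rewrite mxE eqxx.
Qed.

(** * The limsup of k-th roots *)

(** A family of nonnegative numbers f k u v over finitely many u, v has
    exponential rate rho when it is dominated by every q ^+ k with q > rho, and
    when the maxima over u, v at two consecutive times are not both negligible
    against rho ^+ k. *)
Section RootLimsup.
Variable R : realType.
Implicit Types (a e q r C L : R).

Lemma expr_small q e : 0 <= q < 1 -> 0 < e ->
  exists N, forall k, (N <= k)%N -> q ^+ k <= e.
Proof.
move=> /andP[q0 q1] e0.
have /cvg_expr/cvgr0_norm_le/(_ e e0) : `|q| < 1 by rewrite ger0_norm.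
move=> [N _ hN]; exists N => k Nk.
by rewrite -[leLHS]ger0_norm ?exprn_ge0//; exact: (hN k).
Qed.

Lemma geometric_dominated q a L e : 0 <= q < a -> 0 <= L -> 0 < e ->
  exists N, forall k, (N <= k)%N -> L * q ^+ k <= e * a ^+ k.
Proof.
move=> /andP[q0 qa] L0 e0; have a0 : 0 < a by exact: le_lt_trans qa.
have qa1 : 0 <= q / a < 1 by rewrite divr_ge0 ?(ltW a0)// ltr_pdivrMr ?mul1r.
have L1 : 0 < L + 1 by lra.
have [N hN] := expr_small qa1 (divr_gt0 e0 L1).
exists N => k /hN; rewrite expr_div_n ler_pdivrMr ?exprn_gt0// mulrAC ler_pdivlMr//.
by apply: le_trans; rewrite mulrC ler_wpM2l ?exprn_ge0//; lra.
Qed.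

Lemma powR_inv_le a r k : 0 <= r -> 0 <= a -> (r `^ k.+1%:R^-1 <= a) = (r <= a ^+ k.+1).
Proof.
move=> r0 a0; have k0 : 0 < k.+1%:R^-1 :> R by rewrite invr_gt0.
have aE : a = (a ^+ k.+1) `^ k.+1%:R^-1.
  by rewrite -powR_mulrn// -powRrM mulfV ?powRr1.
rewrite [in LHS]aE; apply/idP/idP; last first.
  by move=> h; rewrite ge0_ler_powR ?nnegrE ?exprn_ge0 ?(ltW k0).
apply: contraTT; rewrite -!ltNge => h.
by rewrite gt0_ltr_powR ?nnegrE ?exprn_ge0.
Qed.

Variables (V : finType) (f : nat -> V -> V -> R) (rho : R).
Hypothesis f_ge0 : forall k u v, 0 <= f k u v.
Hypothesis rho_gt0 : 0 < rho.
Hypothesis rho_lt1 : rho < 1.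
Hypothesis f_upper : forall q, rho < q ->
  exists2 L : R, 0 <= L & forall k u v, f k.+1 u v <= L * q ^+ k.
Hypothesis f_lower : exists2 C : R, 0 < C & forall k e,
  (forall u v, f k.+1 u v <= e /\ f k.+2 u v <= e) -> C * rho ^+ k <= e.

Let rate k : \bar R :=
  (\big[Num.max/0]_u \big[Num.max/0]_v (f k u v `^ k%:R^-1))%:E.

Lemma rate_ge0 k : (0 <= rate k)%E.
Proof. by rewrite lee_fin; exact: bigmax_ge_id. Qed.

Lemma rate_le a k : 0 <= a ->
  ((rate k.+1 <= a%:E)%E <-> forall u v, f k.+1 u v <= a ^+ k.+1).
Proof.
move=> a0; rewrite lee_fin; split=> [h u v|h].
  rewrite -powR_inv_le//; apply: le_trans h.
  exact: le_trans (le_bigmax _ _ v) (le_bigmax _ _ u).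
by apply: bigmax_le => // u _; apply: bigmax_le => // v _; rewrite powR_inv_le.
Qed.

Lemma decay_cvg u v : (fun k => f k u v) @ \oo --> (0 : R).
Proof.
have r0 := rho_gt0; have r1 := rho_lt1.
have [L L0 hL] : exists2 L : R, 0 <= L & forall k u v, f k.+1 u v <= L * ((1 + rho) / 2) ^+ k.
  by apply: f_upper; lra.
rewrite -cvg_shiftS; apply/cvgr0Pnorm_le => e e0.
have q1 : 0 <= (1 + rho) / 2 < 1 by apply/andP; split; lra.
have [N hN] := geometric_dominated q1 L0 e0.
exists N => // k /= /hN; rewrite expr1n mulr1; apply: le_trans.
by rewrite ger0_norm.
Qed.

Lemma limsup_rate : limn_esup rate = rho%:E.
Proof.
have r0 := rho_gt0; have r1 := rho_lt1.
apply/eqP; rewrite eq_le; apply/andP; split.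
  apply/lee_addgt0Pr => e e0; rewrite -EFinD.
  have [L L0 hL] : exists2 L : R, 0 <= L & forall k u v, f k.+1 u v <= L * (rho + e / 2) ^+ k.
    by apply: f_upper; lra.
  have qa : 0 <= rho + e / 2 < rho + e by apply/andP; split; lra.
  have a0 : 0 < rho + e by lra.
  have [N hN] := geometric_dominated qa L0 a0.
  apply: (@le_trans _ _ (ereal_sup (rate @` [set k | (N.+1 <= k)%N]))).
    by apply: ereal_inf_lbound; exists [set k | (N.+1 <= k)%N] => //; exists N.+1.
  apply: ge_ereal_sup => _ [[//|k] /= Nk <-].
  apply/rate_le => [|u v]; first exact: ltW.
  by rewrite (le_trans (hL k u v))// exprS hN.
(* If the rates stayed below some a < rho from N on, then f would be bounded by
   powers of a at all late times, against the lower bound C * rho ^+ k. *)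
apply: le_ereal_inf_tmp => _ [A [N _ NA] <-].
rewrite leNgt; apply/negP => sup_lt.
have rate_sup k : (N <= k)%N -> (rate k <= ereal_sup (rate @` A))%E.
  by move=> Nk; apply: ereal_sup_ubound; exists k => //; exact: NA.
have sup_ge0 : (0 <= ereal_sup (rate @` A))%E.
  exact: le_trans (rate_ge0 N) (rate_sup N _).
case: (ereal_sup _) sup_lt sup_ge0 rate_sup => [a||]//.
rewrite lte_fin lee_fin => ar a0 rate_a.
have [C C0 hC] := f_lower.
have a_rho : 0 <= a < rho by rewrite a0 ar.
have C2 : 0 < C / 2 by lra.
have [M hM] := geometric_dominated a_rho ler01 C2.
have := hM (maxn M N) (leq_maxl _ _); set k := maxn M N.
have Nk : (N <= k)%N by exact: leq_maxr.
have : C * rho ^+ k <= a ^+ k.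
  apply: hC => u v; split.
    have /rate_a/(rate_le _ a0)/(_ u v) : (N <= k.+1)%N by exact: leqW.
    move=> /le_trans; apply; rewrite exprS ler_piMl ?exprn_ge0//; lra.
  have /rate_a/(rate_le _ a0)/(_ u v) : (N <= k.+2)%N by do 2 apply: leqW.
  move=> /le_trans; apply; rewrite !exprS mulrA ler_piMl ?exprn_ge0// mulr_ile1//; lra.
have : 0 < C * rho ^+ k by rewrite mulr_gt0 ?exprn_gt0.
by rewrite mulrAC; lra.
Qed.

End RootLimsup.

(** * The spectrum of a regular graph *)

Lemma path_ge_bounds (R : realDomainType) (x : R) (s : seq R) :
  path >=%R x s -> {in x :: s, forall y, last x s <= y <= x}.
Proof.
elim: s x => [|z s IH] x /=; first by move=> _ y; rewrite inE => /eqP->; rewrite lexx.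
move=> /andP[zx zs] y; rewrite inE => /predU1P[->|ys].
  have /andP[lz _] := IH z zs z (mem_head _ _).
  by rewrite (le_trans lz zx) lexx.
by have /andP[-> yz] := IH z zs y ys; rewrite (le_trans yz zx).
Qed.

(** In a decreasing list the largest absolute value occurs at an end: at the
    first element if it is reached by a nonnegative one, at the last one
    otherwise. *)
Lemma sorted_extreme_norm (R : realDomainType) (x : R) (s : seq R) :
  let lam := Num.max x `|last x s| in
  path >=%R x s ->
  {in x :: s, forall y, `|y| <= lam} /\ exists2 y, y \in x :: s & `|y| = lam.
Proof.
move=> lam /path_ge_bounds sx; split=> [y /sx /andP[ly yx]|].
  rewrite le_max; have [y0|y0] := leP 0 y; apply/orP; [left|right].
    by rewrite ger0_norm.
  by rewrite !ltr0_norm ?lerN2// (le_lt_trans ly).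
have [xl|xl] := leP x `|last x s|.
  by exists (last x s); rewrite ?mem_last// /lam max_r.
exists x; rewrite ?mem_head// /lam max_l ?ltW// ger0_norm//.
exact: le_trans (normr_ge0 _) (ltW xl).
Qed.

Section Spectrum.
Variables (R : realType) (V : finType) (E : rel V) (d : nat).
Hypothesis E_graph : simple_graph E.
Hypothesis E_regular : regular_graph E d.
Local Notation A := (adjacency R E).
Local Notation m := #|V|.

Lemma adjacency_row_sum (i : 'I_m) : \sum_l A i l = d%:R.
Proof.
have /matrixP/(_ i ord0) := adjacency_mul1 E_graph E_regular R.
rewrite mul_mx_diag !mxE mul1r => <-.
by apply: eq_bigr => l _; rewrite !mxE mulr1.
Qed.

(** Compare both sides at a coordinate of Q of largest absolute value. *)
Lemma regular_eigenvalue_le (Q : 'cV[R]_m) (x : R) :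
  Q != 0 -> A *m Q = x *: Q -> `|x| <= d%:R.
Proof.
move=> Q0 AQ.
have [i0 _] : exists i : 'I_m, Q i ord0 != 0.
  by apply/existsP; apply: contraNT Q0; rewrite negb_exists => /forallP h;
     apply/eqP/colP => i; rewrite mxE; apply/eqP; have := h i; rewrite negbK.
case: (arg_maxP (fun i => `|Q i ord0|) (erefl true : predT i0)) => /= i _ imax.
have Qi : 0 < `|Q i ord0|.
  rewrite lt_neqAle normr_ge0 andbT eq_sym; apply: contra_neq Q0 => Qi0.
  apply/colP => l; rewrite mxE; apply/eqP; rewrite -normr_le0 -Qi0; exact: imax.
rewrite -(ler_pM2r Qi) -normrM.
have /colP/(_ i) := AQ; rewrite !mxE => <-.
rewrite (le_trans (ler_norm_sum _ _ _))// -(adjacency_row_sum i) mulr_suml.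
apply: ler_sum => l _; rewrite normrM ger0_norm ?mxE ?ler0n//.
by rewrite ler_wpM2l ?ler0n//; exact: imax.
Qed.

(** The eigenvalue d, carried by the constant vector, heads the sorted list;
    removing it from the list and from the index set alike turns the bound
    on the second and the last eigenvalue into a bound on all remaining D_i,
    attained by one of them.  The hypothesis on d enters through n > 1: the tail
    of the list must not be empty. *)
Lemma graph_spectrum (n : nat) (lam : R) : (3 <= d)%N -> ndlambda_graph E n d lam ->
  exists (P Q : 'M[R]_m) (D : 'rV[R]_m) (i0 : 'I_m),
    [/\ P *m Q = 1%:M, Q *m P = 1%:M, P *m A = diag_mx D *m P &
        A *m Q = Q *m diag_mx D] /\
    [/\ D ord0 i0 = d%:R, (forall i, i != i0 -> `|D ord0 i| <= lam)
      & exists2 i1, i1 != i0 & `|D ord0 i1| = lam].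
Proof.
move=> d3 [_ nE n0 _ [lamE lamd]].
have [P [Q [D [PQ QP PA AQ sD]]]] := symmetric_spectrum (adjacency_sym E_graph R).
have m0 : (0 < m)%N by rewrite nE.
have m2 : (1 < m)%N.
  have /card_gt0P[v _] := m0.
  by rewrite (leq_trans _ (max_card [pred w | E v w]))// E_regular ltnW.
have D_le i : `|D ord0 i| <= d%:R.
  apply: (@regular_eigenvalue_le (col i Q)).
    apply/eqP => Qi0; have /matrixP/(_ i i) := PQ; rewrite !mxE eqxx.
    rewrite big1 => [/esym/eqP|l _]; first by rewrite oner_eq0.
    by have /colP/(_ l) := Qi0; rewrite !mxE => ->; rewrite mulr0.
  apply/colP => l; transitivity ((A *m Q) l i).
    by rewrite !mxE; apply: eq_bigr => r _; rewrite [col i Q _ _]mxE.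
  by rewrite AQ mul_mx_diag !mxE mulrC.
have [i0 Di0] : exists i0, D ord0 i0 = d%:R.
  have P1 : P *m (const_mx 1 : 'cV[R]_m) != 0.
    apply: contraTneq isT => P10.
    have /matrixP/(_ (Ordinal m0) ord0) : (const_mx 1 : 'cV[R]_m) = 0.
      by rewrite -[LHS]mul1mx -QP -mulmxA P10 mulmx0.
    by rewrite !mxE => /eqP; rewrite oner_eq0.
  have [i0 Pi0] : exists i : 'I_m, (P *m (const_mx 1 : 'cV[R]_m)) i ord0 != 0.
    by apply/existsP; apply: contraNT P1; rewrite negb_exists => /forallP h;
       apply/eqP/colP => i; rewrite [RHS]mxE; apply/eqP; have := h i; rewrite negbK.
  exists i0; apply: (mulIf Pi0).
  have := congr1 (fun B => B *m (const_mx 1 : 'cV[R]_m)) PA.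
  rewrite /= -!mulmxA (adjacency_mul1 E_graph E_regular) [LHS]mulmxA => /matrixP/(_ i0 ord0).
  rewrite mul_diag_mx mul_mx_diag [LHS]mxE [RHS]mxE => <-.
  by rewrite [const_mx _ _ _]mxE mulrC.
(* The list rem i0 (enum 'I_m) drops the index i0, not merely the value d. *)
have sD' : perm_eq (eigenvalues A) (d%:R :: [seq D ord0 i | i <- rem i0 (enum 'I_m)]).
  rewrite (perm_trans sD)// -Di0 -map_cons perm_map// perm_to_rem//.
  by rewrite mem_enum.
have ge_tot : total (>=%R : rel R) by move=> x y; exact: le_total.
have := sort_sorted ge_tot _ : sorted >=%R (eigenvalues A).
move: lamE sD sD'; rewrite /graph_eigenvalue.
case: (eigenvalues A) => [|x s] lamE sD sD'; first by have := perm_size sD'.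
move=> xs; have xE : x = d%:R.
  apply/eqP; rewrite eq_le; apply/andP; split.
    have : x \in x :: s by exact: mem_head.
    by rewrite (perm_mem sD) => /mapP[i _ ->]; exact: le_trans (ler_norm _) (D_le i).
  have : (d%:R : R) \in x :: s by rewrite (perm_mem sD') mem_head.
  by move=> /(path_ge_bounds xs)/andP[].
rewrite xE perm_cons in sD'.
have nE' : n = (size s).+1 by have := perm_size sD; rewrite size_map -cardE card_ord nE /= => <-.
case: s => [|y s] in lamE sD sD' xs nE' *; first by rewrite nE nE' in m2.
rewrite nE' /= in lamE xs; rewrite (set_nth_default y) // nth_last /= in lamE.
have /andP[_ ys] := xs.
have [le_lam [z zs zlam]] := sorted_extreme_norm ys.
rewrite -lamE in le_lam zlam.
have memD i : i != i0 -> i \in rem i0 (enum 'I_m).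
  by move=> ii0; rewrite mem_rem_uniq ?enum_uniq// inE ii0 mem_enum.
exists P, Q, D, i0; split=> //; split=> // [i /memD ii0|].
  by apply: le_lam; rewrite (perm_mem sD') map_f.
move: zs; rewrite (perm_mem sD') => /mapP[i1].
rewrite mem_rem_uniq ?enum_uniq// inE => /andP[i1i0 _] zE.
by exists i1; rewrite -?zE.
Qed.

End Spectrum.

(** * Deviation from the uniform distribution *)

Lemma finite_uniform_bound (R : realType) (I : finType) (f : I -> nat -> R)
    (g : nat -> R) : (forall k, 0 <= g k) ->
  (forall i, exists2 L : R, 0 <= L & forall k, f i k <= L * g k) ->
  exists2 L : R, 0 <= L & forall i k, f i k <= L * g k.
Proof.
move=> g0 /fin_all_exists2[L L0 hL].
exists (\sum_i L i) => [|i k]; first by apply: sumr_ge0.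
apply: (le_trans (hL i k)); rewrite ler_wpM2r// (bigD1 i)//= lerDl.
by apply: sumr_ge0.
Qed.

Section Deviation.
Variables (R : realType) (V : finType) (E : rel V) (d : nat).
Hypothesis E_graph : simple_graph E.
Hypothesis E_regular : regular_graph E d.
Hypothesis d_ge3 : (3 <= d)%N.
Local Notation A := (adjacency R E).
Local Notation m := #|V|.
Local Notation b := (d%:R - 1 : R).
Variables (P Q : 'M[R]_m) (D : 'rV[R]_m) (i0 : 'I_m).
Hypothesis PQ : P *m Q = 1%:M.
Hypothesis QP : Q *m P = 1%:M.
Hypothesis PA : P *m A = diag_mx D *m P.
Hypothesis AQ : A *m Q = Q *m diag_mx D.
Hypothesis Di0 : D ord0 i0 = d%:R.
Hypothesis D_lt : forall i, i != i0 -> `|D ord0 i| < d%:R.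

Lemma degree_pred_gt1 : 1 < b.
Proof. by have : 3 <= d%:R :> R; [rewrite ler_nat|lra]. Qed.

Definition deviation k : 'M[R]_m :=
  \matrix_(i, j) (nb_prob R E k (enum_val i) (enum_val j) - m%:R^-1).

Definition normalized_eigenvalue k i : R :=
  geronimus d%:R (D ord0 i) k.+1 / (d%:R * b ^+ k).

(** Pairing the constant vector with an eigenvector of eigenvalue D_i gives the
    same number multiplied by D_i and by d. *)
Lemma const_eigencomponent i : i != i0 ->
  (P *m (const_mx 1 : 'cV[R]_m)) i ord0 = 0 /\
  ((const_mx 1 : 'rV[R]_m) *m Q) ord0 i = 0.
Proof.
move=> ii0; have Dd : D ord0 i != d%:R.
  by have := D_lt ii0; apply: contraTneq => ->; rewrite normr_nat ltxx.
have A1 := adjacency_mul1 E_graph E_regular R.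
have sep x : D ord0 i * x = d%:R * x -> x = 0.
  by move/eqP; rewrite -subr_eq0 -mulrBl mulf_eq0 subr_eq0 (negbTE Dd) => /eqP.
split; apply: sep.
  have := congr1 (mulmx^~ (const_mx 1 : 'cV[R]_m)) PA.
  rewrite /= -!mulmxA A1 [LHS]mulmxA => /matrixP/(_ i ord0).
  rewrite mul_diag_mx mul_mx_diag [LHS]mxE [RHS]mxE => <-.
  by rewrite [const_mx _ _ _]mxE mulrC.
have A1r : (const_mx 1 : 'rV[R]_m) *m A = d%:R *: const_mx 1.
  have := congr1 trmx A1; rewrite !trmx_mul (adjacency_sym E_graph) !trmx_const.
  by rewrite tr_diag_mx diag_const_mx mul_scalar_mx.
have := congr1 (mulmx (const_mx 1 : 'rV[R]_m)) AQ.
rewrite !mulmxA A1r -scalemxAl => /matrixP/(_ ord0 i).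
rewrite mul_mx_diag [LHS]mxE [RHS]mxE => ->.
by rewrite mulrC.
Qed.

(** The constant vector spans the d-eigenspace on either side, so column i0
    of Q and row i0 of P are constant, and P Q = 1 fixes the product of the two
    constants. *)
Lemma uniform_projection k l : Q k i0 * P i0 l = m%:R^-1.
Proof.
pose c := (P *m (const_mx 1 : 'cV[R]_m)) i0 ord0.
pose r := ((const_mx 1 : 'rV[R]_m) *m Q) ord0 i0.
have Qc j : Q j i0 * c = 1.
  have := congr1 (mulmx^~ (const_mx 1 : 'cV[R]_m)) QP.
  rewrite mul1mx -mulmxA => /matrixP/(_ j ord0).
  rewrite !mxE (bigD1 i0)//= big1 ?addr0// => i ii0.
  by rewrite (const_eigencomponent ii0).1 mulr0.
have rP j : r * P i0 j = 1.
  have := congr1 (mulmx (const_mx 1 : 'rV[R]_m)) QP.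
  rewrite mulmx1 mulmxA => /matrixP/(_ ord0 j).
  rewrite !mxE (bigD1 i0)//= big1 ?addr0// => i ii0.
  by rewrite (const_eigencomponent ii0).2 mul0r.
have c0 : c != 0 by apply: contra_eq_neq (Qc k) => ->; rewrite mulr0 eq_sym oner_eq0.
have r0 : r != 0 by apply: contra_eq_neq (rP k) => ->; rewrite mul0r eq_sym oner_eq0.
have QE j : Q j i0 = c^-1 by apply: (mulIf c0); rewrite Qc mulVf.
have PE j : P i0 j = r^-1 by apply: (mulfI r0); rewrite rP mulfV.
have : m%:R * (Q k i0 * P i0 l) = 1.
  have /matrixP/(_ i0 i0) := PQ; rewrite !mxE eqxx mulr1n; apply: eq_trans.
  rewrite (eq_bigr (fun=> Q k i0 * P i0 l)) => [|j _].
    by rewrite sumr_const card_ord mulr_natl.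
  by rewrite !QE !PE mulrC.
have m0 : m%:R != 0 :> R by rewrite pnatr_eq0 -lt0n (leq_trans _ (ltn_ord k)).
by move=> h; apply: (mulfI m0); rewrite h mulfV.
Qed.

(** At i0 the ratio p_k(D_i) / p_k(d) is 1 and its contribution is exactly
    1/n. *)
Lemma deviation_spectral k :
  deviation k.+1 = Q *m diag_mx (\row_i
    (if i == i0 then 0 else normalized_eigenvalue k i)) *m P.
Proof.
have b0 : b != 0 by have := degree_pred_gt1; lra.
have d0 : d%:R != 0 :> R by rewrite pnatr_eq0 -lt0n (leq_trans _ d_ge3).
apply/matrixP => i j; rewrite mul_mx_diag mxE /nb_prob (card_nb_walks_regular E_graph E_regular).
rewrite [RHS]mxE (eq_bigr (fun l => Q i l * normalized_eigenvalue k l * P l j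
   - (if l == i0 then m%:R^-1 else 0))); last first.
  move=> l _; rewrite !mxE; case: eqP => [->|_]; last by rewrite subr0.
  rewrite /normalized_eigenvalue Di0 geronimus_degree divff ?mulr1; last first.
    by rewrite mulf_neq0// expf_neq0.
  by rewrite mulr0 mul0r uniform_projection subrr.
rewrite sumrB -big_mkcond big_pred1_eq; congr (_ - _).
have := nb_matrix_geronimus E_graph E_regular k.+1 AQ.
move=> /(congr1 (mulmx^~ P)); rewrite -mulmxA QP mulmx1 mul_mx_diag => /matrixP/(_ i j).
rewrite [LHS]mxE [RHS]mxE /nb_count => ->; rewrite mulr_suml.
by apply: eq_bigr => l _; rewrite !mxE /normalized_eigenvalue; ring.
Qed.

(** Conversely the deviation determines each ratio, which transfers lower
    bounds from the eigenvalues back to the walk. *)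
Lemma eigenvalue_deviation k i : i != i0 ->
  normalized_eigenvalue k i = (P *m deviation k.+1 *m Q) i i.
Proof.
move=> ii0; rewrite deviation_spectral !mulmxA PQ mul1mx -mulmxA PQ mulmx1.
by rewrite !mxE eqxx (negbTE ii0).
Qed.

Section Eigenvalue.
Variable i : 'I_m.
Hypothesis ii0 : i != i0.
Local Notation x := (D ord0 i).

Lemma eigenvalue_form_gt0 : 0 < d%:R ^+ 2 - x ^+ 2.
Proof.
rewrite subr_gt0 -[x ^+ 2]real_normK ?num_real//.
by rewrite ltrXn2r//= ?D_lt.
Qed.

Lemma normalized_eigenvalue_upper q : char_modulus b x / b < q ->
  exists2 L : R, 0 <= L & forall k, `|normalized_eigenvalue k i| <= L * q ^+ k.
Proof.
have b1 := degree_pred_gt1; have b0 : 0 < b by lra.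
have d0 : 0 < d%:R :> R by lra.
rewrite ltr_pdivrMr// => xq.
have [L L0 hL] := growth_upper (p := fun k => geronimus (d%:R : R) x k.+1)
  b0 eigenvalue_form_gt0 (fun k => geronimusSSS _ _ k) (geronimus_quadratic_form _ _) xq.
exists (L / d%:R) => [|k]; first by rewrite divr_ge0// ltW.
have bk : 0 < b ^+ k by rewrite exprn_gt0.
rewrite normrM normfV [`|d%:R * _|]gtr0_norm ?mulr_gt0// ler_pdivrMr ?mulr_gt0//.
apply: (le_trans (hL k)); rewrite exprMn le_eqVlt; apply/orP; left; apply/eqP.
by field; lra.
Qed.

Lemma normalized_eigenvalue_lower : exists2 C : R, 0 < C & forall k e,
  `|normalized_eigenvalue k i| <= e -> `|normalized_eigenvalue k.+1 i| <= e ->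
  C * (char_modulus b x / b) ^+ k <= e.
Proof.
have b1 := degree_pred_gt1; have b0 : 0 < b by lra.
have d0 : 0 < d%:R :> R by lra.
have [C C0 hC] := growth_lower (p := fun k => geronimus (d%:R : R) x k.+1)
  b0 eigenvalue_form_gt0 (fun k => geronimusSSS _ _ k) (geronimus_quadratic_form _ _).
have db : 0 < d%:R * (1 + b) by rewrite mulr_gt0//; lra.
exists (C / (d%:R * (1 + b))) => [|k e]; first by rewrite divr_gt0.
have bk : 0 < b ^+ k by rewrite exprn_gt0.
rewrite !normrM !normfV ![`|d%:R * _|]gtr0_norm ?mulr_gt0 ?exprn_gt0//.
rewrite !ler_pdivrMr ?mulr_gt0 ?exprn_gt0// => h1 h2.
rewrite expr_div_n mulrAC mulrA ler_pdivrMr// ler_pdivrMr//.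
apply: (le_trans (hC k)); apply: (le_trans (lerD h2 h1)).
rewrite exprS le_eqVlt; apply/orP; left; apply/eqP; ring.
Qed.

End Eigenvalue.

Lemma deviation_upper q :
  0 <= q -> (forall i, i != i0 -> char_modulus b (D ord0 i) / b < q) ->
  exists2 L : R, 0 <= L & forall k i j, `|deviation k.+1 i j| <= L * q ^+ k.
Proof.
move=> q0 hq; have qk k : 0 <= q ^+ k by rewrite exprn_ge0.
pose nu l k := if l == i0 then 0 else normalized_eigenvalue k l.
have [L L0 hL] : exists2 L : R, 0 <= L & forall l k, `|nu l k| <= L * q ^+ k.
  apply: (finite_uniform_bound (f := fun l k => `|nu l k|)) => // l; rewrite /nu.
  case: eqVneq => [_|li0]; last exact/normalized_eigenvalue_upper/hq.
  by exists 0 => // k; rewrite normr0 mul0r.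
have [|M M0 hM] := finite_uniform_bound (g := fun k => q ^+ k)
  (f := fun (ij : 'I_m * 'I_m) k => `|deviation k.+1 ij.1 ij.2|) qk; last first.
  by exists M => // k i j; exact: (hM (i, j)).
move=> [i j] /=; exists (L * \sum_l `|Q i l| * `|P l j|) => [|k].
  by rewrite mulr_ge0// sumr_ge0// => l _; rewrite mulr_ge0.
rewrite deviation_spectral mul_mx_diag mxE (le_trans (ler_norm_sum _ _ _))//.
rewrite mulrAC mulr_sumr; apply: ler_sum => l _; rewrite !mxE !normrM.
rewrite [leLHS]mulrAC [leLHS]mulrC ler_wpM2r ?mulr_ge0//; exact: hL.
Qed.

Lemma deviation_lower i1 : i1 != i0 ->
  exists2 C : R, 0 < C & forall k e,
    (forall i j, `|deviation k.+1 i j| <= e /\ `|deviation k.+2 i j| <= e) ->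
    C * (char_modulus b (D ord0 i1) / b) ^+ k <= e.
Proof.
move=> i1i0; have [C C0 hC] := normalized_eigenvalue_lower i1i0.
pose M := 1 + \sum_j (\sum_l `|P i1 l|) * `|Q j i1|.
have M0 : 0 < M.
  by rewrite ltr_pwDl// sumr_ge0// => j _; rewrite mulr_ge0// sumr_ge0.
have nu_le k e : 0 <= e -> (forall i j, `|deviation k.+1 i j| <= e) ->
    `|normalized_eigenvalue k i1| <= M * e.
  move=> e0 he; rewrite eigenvalue_deviation// mxE (le_trans (ler_norm_sum _ _ _))//.
  rewrite mulrDl mul1r ler_wpDl// mulr_suml; apply: ler_sum => j _.
  rewrite normrM mulrAC ler_wpM2r// mxE (le_trans (ler_norm_sum _ _ _))// mulr_suml.
  by apply: ler_sum => l _; rewrite normrM ler_wpM2l.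
exists (C / M) => [|k e he]; first by rewrite divr_gt0.
have e0 : 0 <= e := le_trans (normr_ge0 _) (he i0 i0).1.
rewrite mulrAC ler_pdivrMr// [leRHS]mulrC.
by apply: hC; apply: nu_le => // i j; case: (he i j).
Qed.

End Deviation.

Theorem theorem1p1 (R : realType) (V : finType) (E : rel V) (n d : nat)
    (lam : R) (hd : (3 <= d)%N) (hG : ndlambda_graph E n d lam) :
  (forall u v : V, (fun k : nat => nb_prob R E k u v) @ \oo --> (n%:R^-1 : R)) /\
  nb_mixing_rate R E =
    ((Num.sqrt (d%:R - 1))^-1 * psi (lam / (2 * Num.sqrt (d%:R - 1))))%:E.
Proof.
have [E_graph nE _ E_regular [_ lam_lt]] := hG.
have [P [Q [D [i0 [[PQ QP PA AQ] [Di0 D_le [i1 i1i0 Di1]]]]]]] :=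
  graph_spectrum E_graph E_regular hd hG.
have b1 := degree_pred_gt1 R hd; set b := d%:R - 1 in b1 *.
have b0 : 0 < b by lra.
have lam0 : 0 <= lam by rewrite -Di1.
have D_lt i : i != i0 -> `|D ord0 i| < d%:R by move=> /D_le/le_lt_trans; apply.
pose rho := char_modulus b lam / b.
have -> : (Num.sqrt b)^-1 * psi (lam / (2 * Num.sqrt b)) = rho.
  rewrite /rho /char_modulus (ger0_norm lam0).
  have w0 : Num.sqrt b != 0 by rewrite gt_eqF// sqrtr_gt0.
  have bE := sqr_sqrtr (ltW b0); move: (psi _) => y.
  by move: (Num.sqrt b) w0 bE => w w0 <-; field.
have rho0 : 0 < rho by rewrite divr_gt0// char_modulus_gt0.
have rho1 : rho < 1.
  by rewrite ltr_pdivrMr// mul1r char_modulus_lt// ger0_norm// /b; lra.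
pose f k u v := `|nb_prob R E k u v - #|V|%:R^-1|.
have devE k u v : f k u v = `|deviation R E k (enum_rank u) (enum_rank v)|.
  by rewrite mxE !enum_rankK.
have f_upper q : rho < q ->
    exists2 L : R, 0 <= L & forall k u v, f k.+1 u v <= L * q ^+ k.
  move=> rq; have [||L L0 hL] := deviation_upper E_graph E_regular hd PQ QP PA AQ Di0 D_lt (q := q).
  - exact: ltW (lt_trans rho0 rq).
  - move=> i /D_le Di; apply: le_lt_trans rq; rewrite ler_pM2r ?invr_gt0//.
    by rewrite char_modulus_homo// (ger0_norm lam0).
  by exists L => // k u v; rewrite devE.
have f_lower : exists2 C : R, 0 < C & forall k e,
    (forall u v, f k.+1 u v <= e /\ f k.+2 u v <= e) -> C * rho ^+ k <= e.
  have [C C0 hC] := deviation_lower E_graph E_regular hd PQ QP PA AQ Di0 D_lt i1i0.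
  exists C => // k e fe.
  have -> : rho = char_modulus b (D ord0 i1) / b.
    by rewrite /rho /char_modulus Di1 (ger0_norm lam0).
  apply: hC => i j; have := fe (enum_val i) (enum_val j).
  by rewrite !devE !enum_valK.
have f_ge0 k u v : 0 <= f k u v by exact: normr_ge0.
split=> [u v|]; last exact: limsup_rate.
have := decay_cvg f_ge0 rho0 rho1 f_upper u v.
rewrite -nE => /cvgr0Pnorm_lt h; apply/cvgrPdist_lt => e e0.
by apply: filterS (h e e0) => k; rewrite normr_id distrC.
Qed.
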